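(* There is an absolute constant $C>0$ such that for every real $m\times n$ matrix $A$ of rank $r$, \[ \operatorname{detlb}A\le\gamma_2(A)\le C\log r\cdot\operatorname{detlb}A . \]
   Context: $\operatorname{detlb}A=\max_k\max_B|\det B|^{1/k}$, where $B$ ranges over all $k\times k$ submatrices of $A$ (any choice of $k$ rows and $k$ columns). For a real $m\times n$ matrix $A$, $\gamma_2(A)=\min\{\|B\|_{2\to\infty}\|C\|_{1\to2}: A=BC\}$, where the minimum is over all factorizations $A=BC$ into real matrices, $\|B\|_{2\to\infty}$ is the largest Euclidean norm of a row of $B$, and $\|C\|_{1\to2}$ is the largest Euclidean norm of a column of $C$.
   Formalization: The factor log r is read as max(1, log r), because with log 1 = 0 the upper bound fails for rank 1 (e.g. A = [1], where γ₂(A) = 1) and log 0 is undefined for rank 0; for r ≥ 2 this only changes the constant C. *)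

(* Defs.v *)
From HB Require Import structures.
From mathcomp Require Import all_boot all_order all_algebra.
From mathcomp Require Import all_classical all_reals.
From mathcomp Require Import exp.
From mathcomp Require Import Rstruct.
Set Implicit Arguments. Unset Strict Implicit. Unset Printing Implicit Defensive.
Import Order.TTheory GRing.Theory Num.Theory.
Local Open Scope classical_set_scope.
Local Open Scope ring_scope.

(* detlb A = max over k >= 1 and over choices of k distinct rows (f) and
   k distinct columns (g) of |det B|^(1/k), B the k x k submatrix.
   Empty max (m = 0 or n = 0) is 0. *)
Definition detlb (R : realType) (m n : nat) (A : 'M[R]_(m, n)) : R :=
  \big[Num.max/0]_(k < (minn m n).+1 | (0 < k)%N)
   \big[Num.max/0]_(f : {ffun 'I_k -> 'I_m} | injectiveb f)
    \big[Num.max/0]_(g : {ffun 'I_k -> 'I_n} | injectiveb g)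
      powR `|\det (mxsub f g A)| (k%:R^-1).

Definition norm_2_inf (R : realType) (m p : nat) (B : 'M[R]_(m, p)) : R :=
  \big[Num.max/0]_(i < m) Num.sqrt (\sum_(j < p) B i j ^+ 2).

Definition norm_1_2 (R : realType) (p n : nat) (C : 'M[R]_(p, n)) : R :=
  \big[Num.max/0]_(j < n) Num.sqrt (\sum_(i < p) C i j ^+ 2).

(* gamma_2 A : infimum (in fact a minimum) over all factorizations A = B C
   with an arbitrary inner dimension p *)
Definition gamma2 (R : realType) (m n : nat) (A : 'M[R]_(m, n)) : R :=
  inf [set x : R | exists (p : nat) (B : 'M[R]_(m, p)) (C : 'M[R]_(p, n)),
                     A = B *m C /\ x = norm_2_inf B * norm_1_2 C].

(* Main.v *)
(** Lower bound: for A = B C, Cauchy-Binet and the Cauchy-Schwarz inequality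
    bound the square of a minor of A by the product of two Gram determinants,
    and AM-GM on the eigenvalues bounds a Gram determinant by the k-th power of
    the largest squared row norm.

    Upper bound: the vectors of squared row norms of B and squared column norms
    of C, over all factorizations A = B C, form a convex set. If s < gamma2 A,
    this set avoids the box [x <= s], so separation yields nonnegative weights
    p, q of total mass 1 with
      sum_i p_i |B_i|^2 + sum_j q_j |C_j|^2 >= s
    for every (bounded) factorization. On the other hand the singular value
    decomposition of M = P^(1/2) A Q^(1/2) gives a factorization for which the
    left-hand side is twice the nuclear norm of M. By Cauchy-Binet the product
    of any k singular values of M is at most (detlb A sqrt(|p| |q|))^k / k!, so
    the k-th largest one is at most e detlb A sqrt(|p| |q|) / k, and summing over
    k <= rank A produces the harmonic number, hence the logarithm. *)

Require Import Defs.
From HB Require Import structures.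
From mathcomp Require Import all_boot all_order all_fingroup all_algebra.
From mathcomp Require Import all_classical all_reals.
From mathcomp Require Import sequences exp.
From mathcomp Require Import complex.
From mathcomp Require Import ring lra.
From mathcomp Require Import Rstruct.
Set Implicit Arguments. Unset Strict Implicit. Unset Printing Implicit Defensive.
Import Order.TTheory GRing.Theory Num.Theory.
Local Open Scope ring_scope.

(** * Cauchy-Binet and Gram determinants *)

(** Multilinearity in the rows: each row of the product is a combination of rows of [B], and [f]
    records which one is picked. *)
Lemma det_mulmx_sum (R : comNzRingType) k n (A : 'M[R]_(k, n)) (B : 'M[R]_(n, k)) :
  \det (A *m B) =
  \sum_(f : {ffun 'I_k -> 'I_n}) (\prod_i A i (f i)) * \det (rowsub f B).
Proof.
rewrite /determinant.
transitivity (\sum_(s : 'S_k) \sum_(f : {ffun 'I_k -> 'I_n})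
    (\prod_i A i (f i)) * ((-1) ^+ s * \prod_i rowsub f B i (s i))).
  apply: eq_bigr => s _.
  transitivity ((-1) ^+ s * \prod_i \sum_j A i j * B j (s i)).
    by congr (_ * _); apply: eq_bigr => i _; rewrite mxE.
  rewrite bigA_distr_bigA mulr_sumr; apply: eq_bigr => f _.
  rewrite big_split /= mulrCA; congr (_ * (_ * _)).
  by apply: eq_bigr => i _; rewrite mxE.
by rewrite exchange_big; apply: eq_bigr => f _; rewrite mulr_sumr.
Qed.

(* The sum runs over all maps, so each k-subset of columns is counted k! times
   and non-injective maps contribute 0. *)
Lemma Cauchy_Binet (R : comNzRingType) k n (A : 'M[R]_(k, n)) (B : 'M[R]_(n, k)) :
  k`!%:R * \det (A *m B) =
  \sum_(f : {ffun 'I_k -> 'I_n}) \det (colsub f A) * \det (rowsub f B).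
Proof.
transitivity (\sum_(s : 'S_k) \sum_(f : {ffun 'I_k -> 'I_n})
    (-1) ^+ s * (\prod_i A i (f (s i))) * \det (rowsub f B)).
  transitivity (\sum_(s : 'S_k) \det (A *m B)).
    by rewrite sumr_const card_Sn mulr_natl.
  apply: eq_bigr => s _; rewrite det_mulmx_sum.
  (* Precomposing [f] with [s] permutes the rows of [rowsub f B], which supplies the sign of [s]. *)
  pose h (f : {ffun 'I_k -> 'I_n}) := [ffun i => f (s i)].
  have hbij : bijective h.
    exists (fun f : {ffun 'I_k -> 'I_n} => [ffun i => f ((s^-1)%g i)]) => f; apply/ffunP=> i;
      by rewrite !ffunE ?permKV ?permK.
  rewrite (reindex h) /=; last by apply: onW_bij.
  apply: eq_bigr => f _.
  have -> : rowsub (h f) B = perm_mx s *m rowsub f B.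
    rewrite -row_permE; apply/matrixP=> i j; by rewrite !mxE ffunE.
  rewrite det_mulmx det_perm mulrA [_ * (-1) ^+ s]mulrC.
  by do 2 congr (_ * _); apply: eq_bigr => i _; rewrite ffunE.
rewrite exchange_big; apply: eq_bigr => f _; rewrite -mulr_suml; congr (_ * _).
by apply: eq_bigr => s _; congr (_ * _); apply: eq_bigr => i _; rewrite mxE.
Qed.

(** Lagrange's identity: twice the gap between the two sides is a double sum of squares. *)
Lemma sum_CauchySchwarz (R : realFieldType) (I : finType) (a b : I -> R) :
  (\sum_i a i * b i) ^+ 2 <= (\sum_i a i ^+ 2) * (\sum_i b i ^+ 2).
Proof.
have H : 0 <= \sum_i \sum_j (a i * b j - a j * b i) ^+ 2.
  by apply: sumr_ge0 => i _; apply: sumr_ge0 => j _; exact: sqr_ge0.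
have E : \sum_i \sum_j (a i * b j - a j * b i) ^+ 2 =
   ((\sum_i a i ^+ 2) * (\sum_i b i ^+ 2)) *+ 2 - ((\sum_i a i * b i) ^+ 2) *+ 2.
  transitivity (\sum_i \sum_j (a i ^+ 2 * b j ^+ 2 + b i ^+ 2 * a j ^+ 2
       - (a i * b i * (a j * b j)) *+ 2)).
    by apply: eq_bigr => i _; apply: eq_bigr => j _; ring.
  rewrite (eq_bigr (fun i => a i ^+ 2 * (\sum_j b j ^+ 2) +
     b i ^+ 2 * (\sum_j a j ^+ 2) - (a i * b i * \sum_j a j * b j) *+ 2)); last first.
    by move=> i _; rewrite sumrB big_split /= !mulr_sumr sumrMnl.
  by rewrite sumrB big_split /= sumrMnl -!mulr_suml; ring.
by move: H; rewrite E -mulrnBl pmulrn_lge0 // subr_ge0.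
Qed.

Lemma det_gram (R : comNzRingType) k n (A : 'M[R]_(k, n)) :
  k`!%:R * \det (A *m A^T) =
  \sum_(f : {ffun 'I_k -> 'I_n}) \det (colsub f A) ^+ 2.
Proof.
rewrite Cauchy_Binet; apply: eq_bigr => f _.
by rewrite -trmx_mxsub det_tr expr2.
Qed.

Lemma det_mulmx_sqr_le (R : realFieldType) k n (A : 'M[R]_(k, n)) (B : 'M[R]_(n, k)) :
  \det (A *m B) ^+ 2 <= \det (A *m A^T) * \det (B^T *m B).
Proof.
have k0 : 0 < k`!%:R :> R by rewrite ltr0n fact_gt0.
rewrite -(ler_pM2l (exprn_gt0 2 k0)) -exprMn Cauchy_Binet.
rewrite (le_trans (sum_CauchySchwarz _ _)) //.
rewrite expr2 mulrACA det_gram -{3}(trmxK B) det_gram.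
by under [X in _ <= _ * X]eq_bigr do rewrite -trmx_mxsub det_tr.
Qed.

(** * Spectral theorem for real symmetric matrices *)

(** Over [R[i]] the matrix is Hermitian, so its spectral diagonal is real; being a root of the
    characteristic polynomial then descends to [R]. *)
Lemma symmetric_eigenvalue (R : rcfType) n (G : 'M[R]_n.+1) :
  G^T = G -> exists a : R, eigenvalue G a.
Proof.
move=> symG; pose GC : 'M[R[i]]_n.+1 := map_mx (real_complex R) G.
have hermG : GC \is hermsymmx.
  apply: realsym_hermsym.
    by apply/is_hermitianmxP; rewrite expr0 scale1r /GC -{1}symG; apply/matrixP=> i j; rewrite !mxE.
  by apply/mxOverP=> i j; rewrite mxE; apply/complex_realP; exists (G i j).
have [a spa] : exists a : R, spectral_diag GC 0 0 = (real_complex R) a.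
  apply/complex_realP.
  by have /mxOverP := hermitian_spectral_diag_real hermG; apply.
exists a; rewrite eigenvalue_root_char -(fmorph_root (real_complex R)).
rewrite map_char_poly -eigenvalue_root_char.
apply/eigenvalueP; exists (row 0 (spectralmx GC)); last first.
  apply/eqP => r0; have := spectral_unit GC.
  rewrite -row_free_unit => /row_freeP[B] /(congr1 (row 0)).
  rewrite row_mul r0 mul0mx => /rowP/(_ 0) /eqP.
  by rewrite !mxE eqxx eq_sym oner_eq0.
have /orthomx_spectralP E := hermitian_normalmx hermG.
have PG : spectralmx GC *m GC = diag_mx (spectral_diag GC) *m spectralmx GC.
  by rewrite [X in _ *m X = _]E !mulmxA mulmxV ?spectral_unit // mul1mx.
rewrite -row_mul PG row_mul row_diag_mx -scalemxAl -rowE.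
by congr (_ *: _).
Qed.

Lemma mulmx_tr_gt0 (R : realFieldType) n (u : 'rV[R]_n) :
  u != 0 -> 0 < (u *m u^T) 0 0.
Proof.
move=> u0; rewrite mxE lt_neqAle eq_sym psumr_neq0 => [|i _]; last first.
  by rewrite mxE -expr2 sqr_ge0.
rewrite sumr_ge0 ?andbT => [|i _]; last by rewrite mxE -expr2 sqr_ge0.
have /rV0Pn[j uj] := u0; apply/hasP; exists j; first by rewrite mem_index_enum.
by rewrite mxE -expr2 lt_neqAle sqr_ge0 eq_sym sqrf_eq0 uj.
Qed.

(* Householder reflection exchanging u and the first basis vector. *)
Lemma orthogonal_first_row (R : realFieldType) n (u : 'rV[R]_n.+1) :
  u *m u^T = 1%:M ->
  exists2 H : 'M[R]_n.+1, H *m H^T = 1%:M & delta_mx 0 0 *m H = u.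
Proof.
move=> u1; pose e : 'rV[R]_n.+1 := delta_mx 0 0.
have [<-|ue] := eqVneq e u.
  by exists 1%:M; rewrite ?trmx1 mulmx1.
pose w : 'rV[R]_n.+1 := u - e; pose c : R := (w *m w^T) 0 0.
have c0 : 0 < c by apply: mulmx_tr_gt0; rewrite subr_eq0 eq_sym.
have wwE : w *m w^T = c%:M by rewrite -mx11_scalar.
have eeT : e *m e^T = 1%:M by rewrite trmx_delta mul_delta_mx; apply/rowP=> i; rewrite !mxE !ord1.
pose b : R := (e *m w^T) 0 0.
have ewE : e *m w^T = b%:M by rewrite -mx11_scalar.
(* Since [u] and [e] are unit vectors, |u - e|^2 = -2 <e, u - e>; hence the reflection along [w]
   sends [e] to [e + w = u]. *)
have cb : c = - b *+ 2.
  have ueE : (u *m e^T) 0 0 = (e *m u^T) 0 0.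
    by rewrite -[in RHS](trmxK e) -trmx_mul [in RHS]mxE.
  rewrite /c /b /w linearB /= mulmxBr mulmxBl mulmxBl mulmxBr u1 eeT.
  move: ueE; set x := u *m e^T; set y := e *m u^T => ueE.
  have E (X Y : 'M[R]_1) : (X - Y) 0 0 = X 0 0 - Y 0 0 by rewrite !mxE.
  by rewrite !E ueE; rewrite !mxE /=; ring.
exists (1%:M - (2 / c) *: (w^T *m w)).
  rewrite [X in _ *m X]linearB [X in _ *m (_ - X)]linearZ /= trmx1 trmx_mul trmxK.
  rewrite mulmxBr mulmx1 mulmxBl mul1mx -scalemxAl -scalemxAr.
  rewrite mulmxA -[w^T *m w *m w^T]mulmxA wwE mul_mx_scalar -scalemxAl.
  rewrite !scalerA.
  have -> : 2 / c * (2 / c * c) = 2 / c + 2 / c by field; rewrite gt_eqF.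
  by rewrite scalerDl opprB addrK subrK.
rewrite mulmxBr mulmx1 -scalemxAr mulmxA -/e ewE mul_scalar_mx scalerA.
have -> : 2 / c * b = -1.
  have b0 : b != 0 by apply: contraTneq c0 => b0; rewrite cb b0 oppr0 mul0rn ltxx.
  by rewrite cb; field.
by rewrite scaleN1r opprK /w addrC subrK.
Qed.

(** Deflation: rotating a unit eigenvector to the first basis vector makes the matrix block
    diagonal, and induction treats the remaining block. *)
Lemma symmetric_spectral (R : rcfType) n (G : 'M[R]_n) : G^T = G ->
  exists (V : 'M[R]_n) (l : 'rV[R]_n),
    V *m V^T = 1%:M /\ V *m G *m V^T = diag_mx l.
Proof.
elim: n G => [|n IHn] G symG.
  by exists 1%:M, 0; split; apply/matrixP=> -[].
have [a /eigenvalueP[v vG v0]] := symmetric_eigenvalue symG.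
pose c : R := (v *m v^T) 0 0; have c0 : 0 < c := mulmx_tr_gt0 v0.
pose u := (Num.sqrt c)^-1 *: v.
have uG : u *m G = a *: u by rewrite -scalemxAl vG !scalerA mulrC.
have u1 : u *m u^T = 1%:M.
  rewrite linearZ /= -scalemxAl -scalemxAr scalerA -expr2 exprVn sqr_sqrtr ?ltW//.
  by rewrite [_ *m _]mx11_scalar -/c scale_scalar_mx mulVf ?gt_eqF.
have [H H1 Hu] := orthogonal_first_row u1.
have [K KE] : {K : 'M[R]_(1 + n) | K = H *m G *m H^T} by eexists.
have symK : K^T = K by rewrite KE !trmx_mul trmxK symG mulmxA.
have K0 j : K 0 j = a * (j == 0)%:R.
  have -> : K 0 j = (delta_mx (0 : 'I_1) 0 *m K) 0 j by rewrite -rowE [RHS]mxE.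
  rewrite KE !mulmxA Hu uG -scalemxAl -Hu -mulmxA H1 mulmx1.
  by rewrite !mxE eqxx /= eq_sym.
have usK : ursubmx K = 0.
  apply/matrixP=> i j; rewrite !mxE ord1.
  have -> : lshift n (0 : 'I_1) = 0 by apply: val_inj.
  by rewrite K0 -val_eqE /= mulr0.
have dsK : dlsubmx K = 0 by rewrite -symK -trmx_ursub usK trmx0.
have ulK : ulsubmx K = a%:M.
  rewrite [LHS]mx11_scalar; congr (_%:M); rewrite !mxE.
  have -> : lshift n (0 : 'I_1) = 0 by apply: val_inj.
  by rewrite K0 eqxx mulr1.
have symD : (drsubmx K)^T = drsubmx K by rewrite trmx_drsub symK.
have [V [l [V1 VD]]] := IHn _ symD.
pose W : 'M[R]_(1 + n) := block_mx 1%:M 0 0 V.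
have W1 : W *m W^T = 1%:M.
  rewrite /W tr_block_mx !trmx0 trmx1 mulmx_block.
  by rewrite !(mulmx0, mul0mx, mulmx1, addr0, add0r) V1 -scalar_mx_block.
exists (W *m H), (row_mx a%:M l); split.
  by rewrite trmx_mul mulmxA -(mulmxA W) H1 mulmx1 W1.
rewrite trmx_mul !mulmxA.
have -> : W *m H *m G *m H^T *m W^T = W *m K *m W^T by rewrite KE !mulmxA.
rewrite -(submxK K) usK dsK ulK /W tr_block_mx !trmx0 trmx1.
rewrite !mulmx_block !(mulmx0, mul0mx, mulmx1, mul1mx, addr0, add0r) VD.
have dE := diag_mx_row (a%:M : 'rV[R]_1) l.
have aE : diag_mx (a%:M : 'rV[R]_1) = a%:M.
  by apply/matrixP=> i j; rewrite !mxE !ord1 /= mulr1n.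
by move: dE; rewrite aE => /esym.
Qed.

(** * Spectrum and determinant of Gram matrices *)

Section GramSpectrum.
Variable R : rcfType.

Lemma gram_diag_ge0 m n (B : 'M[R]_(m, n)) i : 0 <= (B *m B^T) i i.
Proof. by rewrite mxE sumr_ge0 // => j _; rewrite mxE -expr2 sqr_ge0. Qed.

Lemma gram_spectral m n (B : 'M[R]_(m, n)) :
  exists (V : 'M[R]_m) (l : 'rV[R]_m),
    [/\ V *m V^T = 1%:M, V *m (B *m B^T) *m V^T = diag_mx l
      & forall i, 0 <= l 0 i].
Proof.
have [|V [l [V1 Vl]]] := @symmetric_spectral _ _ (B *m B^T).
  by rewrite trmx_mul trmxK.
exists V, l; split=> // i.
have -> : l 0 i = diag_mx l i i by rewrite mxE eqxx mulr1n.
rewrite -Vl mulmxA -(mulmxA (V *m B)) -trmx_mul; exact: gram_diag_ge0.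
Qed.

Lemma det_gram_le m n (B : 'M[R]_(m, n)) c :
  (forall i, \sum_j B i j ^+ 2 <= c) -> \det (B *m B^T) <= c ^+ m.
Proof.
move=> Bc; case: m B Bc => [|m] B Bc; first by rewrite det_mx00 expr0.
have [V [l [V1 Vl l0]]] := gram_spectral B.
have VT1 : V^T *m V = 1%:M by apply: mulmx1C.
have -> : \det (B *m B^T) = \prod_i l 0 i.
  rewrite -det_diag -Vl !det_mulmx mulrC mulrA -det_mulmx.
  by rewrite VT1 det1 mul1r.
have [/= + _] := @leif_AGM R _ predT (fun i => l 0 i) (fun i _ => l0 i).
rewrite card_ord => /le_trans; apply.
have -> : \sum_i l 0 i = \sum_i \sum_j B i j ^+ 2.
  rewrite -mxtrace_diag -Vl mxtrace_mulC !mulmxA VT1 mul1mx.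
  apply: eq_bigr => i _; rewrite mxE; apply: eq_bigr => j _.
  by rewrite mxE expr2.
have S0 : 0 <= \sum_i \sum_j B i j ^+ 2.
  by apply: sumr_ge0 => i _; apply: sumr_ge0 => j _; exact: sqr_ge0.
apply: lerXn2r; rewrite ?nnegrE ?divr_ge0 ?ler0n //.
  by apply: le_trans (Bc 0); apply: sumr_ge0 => j _; exact: sqr_ge0.
rewrite ler_pdivrMr ?ltr0n // mulr_natr.
by apply: (le_trans (ler_sum _ (fun i _ => Bc i))); rewrite sumr_const card_ord.
Qed.

End GramSpectrum.

(** * Determinants of factored matrices against [detlb] *)

Section DetLowerBound.
Variable R : realType.

Lemma norm_2_inf_ge0 m p (B : 'M[R]_(m, p)) : 0 <= norm_2_inf B.
Proof. exact: bigmax_ge_id. Qed.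

Lemma norm_1_2_tr p n (C : 'M[R]_(p, n)) : norm_1_2 C = norm_2_inf C^T.
Proof.
by apply: eq_bigr => j _; congr Num.sqrt; apply: eq_bigr => i _; rewrite mxE.
Qed.

Lemma row_le_norm_2_inf m p (B : 'M[R]_(m, p)) i :
  \sum_j B i j ^+ 2 <= norm_2_inf B ^+ 2.
Proof.
have s0 : 0 <= \sum_j B i j ^+ 2 by apply: sumr_ge0 => j _; exact: sqr_ge0.
rewrite -[leLHS]sqr_sqrtr //; apply: lerXn2r; rewrite ?nnegrE ?sqrtr_ge0 //.
  exact: norm_2_inf_ge0.
exact: (le_bigmax _ (fun i => Num.sqrt (\sum_j B i j ^+ 2))).
Qed.

Lemma det_factor_le k p (B : 'M[R]_(k, p)) (C : 'M[R]_(p, k)) (b c : R) :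
  0 <= b -> 0 <= c -> (forall i, \sum_j B i j ^+ 2 <= b ^+ 2) ->
  (forall j, \sum_i C i j ^+ 2 <= c ^+ 2) -> `|\det (B *m C)| <= (b * c) ^+ k.
Proof.
move=> b0 c0 Bb Cc.
rewrite -ler_sqr ?nnegrE ?exprn_ge0 ?mulr_ge0 // real_normK ?num_real //.
apply: (le_trans (det_mulmx_sqr_le _ _)).
rewrite exprAC [(b * c) ^+ 2]exprMn exprMn; apply: ler_pM.
- by rewrite -(pmulr_rge0 _ (_ : 0 < k`!%:R)) ?ltr0n ?fact_gt0 // det_gram
    sumr_ge0 // => f _; exact: sqr_ge0.
- rewrite -{2}(trmxK C) -(pmulr_rge0 _ (_ : 0 < k`!%:R)) ?ltr0n ?fact_gt0 //.
  by rewrite det_gram sumr_ge0 // => f _; exact: sqr_ge0.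
- exact: det_gram_le.
- rewrite -{2}(trmxK C); apply: det_gram_le => j.
  by under eq_bigr do rewrite mxE.
Qed.

Lemma detlb_ge0 m n (A : 'M[R]_(m, n)) : 0 <= detlb A.
Proof. exact: bigmax_ge_id. Qed.

Lemma detlb_le_factorization m n p (B : 'M[R]_(m, p)) (C : 'M[R]_(p, n)) :
  detlb (B *m C) <= norm_2_inf B * norm_1_2 C.
Proof.
have bc0 : 0 <= norm_2_inf B * norm_1_2 C.
  by rewrite norm_1_2_tr mulr_ge0 ?norm_2_inf_ge0.
apply: bigmax_le => // k k0; apply: bigmax_le => // f _.
apply: bigmax_le => // g _.
have le_det : `|\det (mxsub f g (B *m C))| <= (norm_2_inf B * norm_1_2 C) ^+ k.
  rewrite mxsub_mul; apply: det_factor_le; rewrite ?norm_1_2_tr ?norm_2_inf_ge0 //.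
    by move=> i; under eq_bigr do rewrite mxE; exact: row_le_norm_2_inf.
  move=> j; apply: le_trans (row_le_norm_2_inf _ (g j)).
  by apply: ler_sum => i _; rewrite !mxE.
apply: (le_trans (ge0_ler_powR _ _ _ le_det)).
- by rewrite invr_ge0.
- by rewrite nnegrE.
- by rewrite nnegrE exprn_ge0.
- by rewrite -powR_mulrn // -powRrM divff ?pnatr_eq0 -?lt0n // powRr1.
Qed.

(** Arbitrary maps are allowed because the Cauchy-Binet sums run over them; a repeated row or column
    makes the minor vanish. *)
Lemma det_le_detlb m n (A : 'M[R]_(m, n)) k (f : {ffun 'I_k -> 'I_m})
    (g : {ffun 'I_k -> 'I_n}) :
  `|\det (mxsub f g A)| <= detlb A ^+ k.
Proof.
case: (posnP k) f g => [->|k0] f g; first by rewrite det_mx00 normr1 expr0.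
have [injf|] := boolP (injectiveb f); last first.
  case/injectivePn => i [j ij fij]; rewrite (determinant_alternate ij).
    by rewrite normr0 exprn_ge0 ?detlb_ge0.
  by move=> l; rewrite !mxE fij.
have [injg|] := boolP (injectiveb g); last first.
  case/injectivePn => i [j ij gij]; rewrite -det_tr (determinant_alternate ij).
    by rewrite normr0 exprn_ge0 ?detlb_ge0.
  by move=> l; rewrite !mxE gij.
have km : (k <= minn m n)%N.
  rewrite leq_min; apply/andP; split.
    by have := leq_card f (injectiveP _ injf); rewrite !card_ord.
  by have := leq_card g (injectiveP _ injg); rewrite !card_ord.
have le_lb : `|\det (mxsub f g A)| `^ k%:R^-1 <= detlb A.
  pose k' : 'I_(minn m n).+1 := Ordinal (n:=(minn m n).+1) (m:=k) km.
  apply: (bigmax_sup k') => //; apply: (bigmax_sup f) => //.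
  by apply: (bigmax_sup g).
have := lerXn2r k _ _ le_lb; rewrite !nnegrE powR_ge0 detlb_ge0.
by rewrite -[(_ `^ _) ^+ k]powR_mulrn ?powR_ge0 // -powRrM mulVf ?pnatr_eq0 -?lt0n // powRr1 //; apply.
Qed.

End DetLowerBound.

(** * Factorial and harmonic estimates *)

Section Numeric.
Variable R : realType.

(** Induction on [k] through (1 + 1/k)^k <= e. *)
Lemma expn_le_fact k : k%:R ^+ k <= expR 1 ^+ k * k`!%:R :> R.
Proof.
elim: k => [|k IHk]; first by rewrite !expr0 mul1r.
have [->|k0] := posnP k.
  by rewrite !expr1 mulr1 (le_trans _ (expR_ge1Dx _)) // lerDl.
have kR : 0 < k%:R :> R by rewrite ltr0n.
have step : k.+1%:R ^+ k <= k%:R ^+ k * expR 1 :> R.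
  have -> : expR 1 = expR (k%:R^-1) ^+ k :> R.
    by rewrite -expRM_natl mulrC mulVf ?gt_eqF.
  rewrite -exprMn; apply: lerXn2r; rewrite ?nnegrE ?mulr_ge0 ?expR_ge0 ?ler0n //.
  have : k%:R * (1 + k%:R^-1) <= k%:R * expR (k%:R^-1) :> R.
    by rewrite ler_pM2l ?expR_ge1Dx.
  by rewrite mulrDr mulfV ?gt_eqF // mulr1 natr1.
rewrite factS natrM exprS (exprS (expR 1)).
have -> : expR 1 * expR 1 ^+ k * (k.+1%:R * k`!%:R) =
    k.+1%:R * (expR 1 * (expR 1 ^+ k * k`!%:R)) :> R by ring.
rewrite ler_pM2l ?ltr0n //; apply: (le_trans step).
by rewrite mulrC ler_pM2l ?expR_gt0.
Qed.

(** The usual bound 1 + ln r is at most twice the maximum of its two terms; the maximum with 1 also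
    covers r <= 1, where the logarithm gives nothing. *)
Lemma harmonic_le_ln r :
  \sum_(k < r) k.+1%:R^-1 <= 2 * Num.max 1 (ln r%:R) :> R.
Proof.
case: r => [|r]; first by rewrite big_ord0 mulr_ge0 // le_max ler01.
suff H : \sum_(k < r.+1) k.+1%:R^-1 <= 1 + ln r.+1%:R :> R.
  apply: (le_trans H); rewrite mulr_natl mulr2n.
  by apply: lerD; rewrite le_max lexx ?orbT.
elim: r => [|r IHr]; first by rewrite big_ord1 invr1 ln1 addr0.
rewrite big_ord_recr /= (le_trans (lerD IHr (lexx _))) // -addrA lerD2l.
have r1 : 0 < r.+1%:R :> R by rewrite ltr0n.
have r2 : 0 < r.+2%:R :> R by rewrite ltr0n.
(* At this point the inequality reads ln((r+1)/(r+2)) <= -1/(r+2), which is the induction step. *)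
have := @le_ln1Dx R (- r.+2%:R^-1).
rewrite ltrN2 invf_lt1 // ltr1n => /(_ isT).
have -> : 1 - r.+2%:R^-1 = r.+1%:R / r.+2%:R :> R.
  apply: (mulIf (lt0r_neq0 r2)); rewrite mulrBl mulVf ?gt_eqF // mul1r.
  by rewrite divfK ?gt_eqF // -[r.+2%:R]natr1 addrK.
by rewrite ln_div ?posrE // lerBlDr [- _ + _]addrC lerBrDr.
Qed.

(* Remove the smallest x i first: it is at most the geometric mean of the whole
   family, hence at most e c / #|S|. *)
Lemma sum_le_harmonic (I : finType) (x : I -> R) (c : R) (S : {set I}) :
    0 <= c -> (forall i, 0 <= x i) ->
    (forall T : {set I}, T \subset S ->
       \prod_(i in T) x i <= c ^+ #|T| / (#|T|)`!%:R) ->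
  \sum_(i in S) x i <= expR 1 * c * \sum_(k < #|S|) k.+1%:R^-1.
Proof.
move=> c0 x0; move: {2}#|S| (erefl #|S|) => k; elim: k S => [|k IHk] S Sk HS.
  by move/eqP: Sk; rewrite cards_eq0 => /eqP ->; rewrite big_set0 cards0 big_ord0 mulr0.
have [i0 i0S] : exists i0, i0 \in S by apply/set0Pn; rewrite -card_gt0 Sk.
case: (@Order.TotalTheory.arg_minP _ R I i0 (mem S) x i0S) => i /= iS imin.
have {}iS : i \in S by [].
have Sik : #|S :\ i| = k by apply: succn_inj; rewrite -Sk (cardsD1 i S) iS.
rewrite (big_setD1 i) //= Sk big_ord_recr /= mulrDr addrC; apply: lerD.
  have := IHk _ Sik; rewrite Sik; apply=> T TS; apply: HS.
  exact: fintype.subset_trans TS (subD1set _ _).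
have kR : 0 < k.+1%:R :> R by rewrite ltr0n.
have := HS S (subxx _); rewrite Sk => HSS.
have xk : x i ^+ k.+1 <= \prod_(j in S) x j.
  rewrite -Sk -prodr_const; apply: ler_prod => j jS.
  by rewrite x0 imin.
rewrite -(@ler_pXn2r _ k.+1) ?nnegrE ?mulr_ge0 ?expR_ge0 ?invr_ge0 ?ler0n //.
apply: (le_trans xk); apply: (le_trans HSS).
rewrite ler_pdivrMr ?ltr0n ?fact_gt0 //.
rewrite [expR 1 * c]mulrC -mulrA exprMn -[leLHS]mulr1 -mulrA.
apply: ler_wpM2l; first exact: exprn_ge0.
rewrite exprMn exprVn mulrAC ler_pdivlMr ?exprn_gt0 // mul1r.
exact: expn_le_fact.
Qed.

End Numeric.

(** * Minors of the weighted matrix *)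

Section WeightedFactorization.
Variable R : realType.

(** Cauchy-Binet is applied twice, once for rows and once for columns, hence the squared factorial.
    In between, orthonormality of the rows of [N] makes its Gram determinant 1. *)
Lemma det_mul_orthonormal_le k m n (M : 'M[R]_(m, n)) (N : 'M[R]_(k, n)) :
  N *m N^T = 1%:M ->
  k`!%:R ^+ 2 * \det (N *m (M^T *m M) *m N^T) <=
  \sum_(f : {ffun 'I_k -> 'I_m}) \sum_(g : {ffun 'I_k -> 'I_n})
     \det (mxsub f g M) ^+ 2.
Proof.
move=> N1.
have -> : N *m (M^T *m M) *m N^T = (M *m N^T)^T *m (M *m N^T)^T^T.
  by rewrite trmxK trmx_mul trmxK !mulmxA.
rewrite expr2 -mulrA det_gram mulr_sumr; apply: ler_sum => f _.
have -> : \det (colsub f (M *m N^T)^T) = \det (rowsub f M *m N^T).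
  by rewrite -trmx_mxsub det_tr mul_rowsub_mx.
apply: (@le_trans _ _ (k`!%:R * \det (rowsub f M *m (rowsub f M)^T))).
  rewrite ler_pM2l ?ltr0n ?fact_gt0 //.
  by have := det_mulmx_sqr_le (rowsub f M) N^T; rewrite trmxK N1 det1 mulr1.
rewrite det_gram; apply: ler_sum => g _.
by rewrite (_ : colsub g _ = mxsub f g M) //; apply/matrixP=> i j; rewrite !mxE.
Qed.

Definition weighted_mx m n (A : 'M[R]_(m, n)) (p : 'I_m -> R) (q : 'I_n -> R) :
    'M[R]_(m, n) :=
  \matrix_(i, j) (Num.sqrt (p i) * A i j * Num.sqrt (q j)).

(** A minor of the weighted matrix is a minor of [A] times square roots of weights. Summed over all
    maps, the products of weights are exactly the k-th powers of the total masses. *)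
Lemma weighted_minors_le k m n (A : 'M[R]_(m, n)) (p : 'I_m -> R) (q : 'I_n -> R) :
    (forall i, 0 <= p i) -> (forall j, 0 <= q j) ->
  \sum_(f : {ffun 'I_k -> 'I_m}) \sum_(g : {ffun 'I_k -> 'I_n})
     \det (mxsub f g (weighted_mx A p q)) ^+ 2 <=
  (detlb A ^+ 2 * (\sum_i p i) * (\sum_j q j)) ^+ k.
Proof.
move=> p0 q0.
have sumX d (a : 'I_d -> R) :
    (\sum_i a i) ^+ k = \sum_(f : {ffun 'I_k -> 'I_d}) \prod_i a (f i).
  rewrite -(bigA_distr_bigA (fun (_ : 'I_k) j => a j)) /=.
  by rewrite prodr_const card_ord.
rewrite exprMn exprMn !sumX -mulrA mulr_suml mulr_sumr.
apply: ler_sum => f _; rewrite mulr_sumr mulr_sumr; apply: ler_sum => g _.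
have -> : mxsub f g (weighted_mx A p q) = diag_mx (\row_i Num.sqrt (p (f i))) *m mxsub f g A
     *m diag_mx (\row_j Num.sqrt (q (g j))).
  by rewrite mul_diag_mx mul_mx_diag; apply/matrixP=> i j; rewrite !mxE.
rewrite !det_mulmx !det_diag !exprMn -!prodrXl.
have -> : \prod_i (\row_i Num.sqrt (p (f i))) 0 i ^+ 2 = \prod_i p (f i).
  by apply: eq_bigr => i _; rewrite mxE sqr_sqrtr.
have -> : \prod_j (\row_j Num.sqrt (q (g j))) 0 j ^+ 2 = \prod_j q (g j).
  by apply: eq_bigr => j _; rewrite mxE sqr_sqrtr.
rewrite mulrAC mulrC ler_wpM2r //.
  by rewrite mulr_ge0 // prodr_ge0.
rewrite -real_normK ?num_real // -expr2.
by apply: lerXn2r; rewrite ?nnegrE ?exprn_ge0 ?detlb_ge0 ?det_le_detlb.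
Qed.

End WeightedFactorization.

(** * Singular values and the nuclear norm factorization *)

Section NuclearFactorization.
Variable R : realType.

Lemma rowsub_orthonormal k n (V : 'M[R]_n) (h : 'I_k -> 'I_n) :
  injective h -> V *m V^T = 1%:M -> rowsub h V *m (rowsub h V)^T = 1%:M.
Proof.
move=> hinj V1; rewrite trmx_mxsub -mxsub_mul V1.
by apply/matrixP=> i j; rewrite !mxE (inj_eq hinj).
Qed.

Lemma diag_submx_spectrum m n (M : 'M[R]_(m, n)) (V : 'M[R]_n) (l : 'rV[R]_n)
    k (h : 'I_k -> 'I_n) :
  injective h -> V *m (M^T *m M) *m V^T = diag_mx l ->
  rowsub h V *m (M^T *m M) *m (rowsub h V)^T = diag_mx (\row_i l 0 (h i)).
Proof.
move=> hinj Vl; rewrite trmx_mxsub mul_rowsub_mx -mxsub_mul Vl.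
by apply/matrixP=> i j; rewrite !mxE (inj_eq hinj).
Qed.

(** The [l 0 i] are squared singular values of [M]; compressing to the rows of [V] indexed by [T]
    turns their product into a determinant. *)
Lemma prod_spectrum_le m n (A : 'M[R]_(m, n)) (p : 'I_m -> R) (q : 'I_n -> R)
    (V : 'M[R]_n) (l : 'rV[R]_n) (M := weighted_mx A p q) (T : {set 'I_n}) :
    (forall i, 0 <= p i) -> (forall j, 0 <= q j) ->
    V *m V^T = 1%:M -> V *m (M^T *m M) *m V^T = diag_mx l ->
  (#|T|)`!%:R ^+ 2 * \prod_(i in T) l 0 i <=
    (detlb A ^+ 2 * (\sum_i p i) * (\sum_j q j)) ^+ #|T|.
Proof.
move=> p0 q0 V1 Vl.
have hinj : injective (fun i : 'I_#|T| => enum_val i) by exact: enum_val_inj.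
have := det_mul_orthonormal_le M (rowsub_orthonormal hinj V1).
rewrite (diag_submx_spectrum hinj Vl) det_diag [in X in _ -> X]big_enum_val /=.
under eq_bigr do rewrite mxE.
by move=> /le_trans; apply; exact: weighted_minors_le.
Qed.

(** The compression to [T] is an invertible diagonal matrix that factors through [A]. *)
Lemma card_spectrum_le m n (A : 'M[R]_(m, n)) (p : 'I_m -> R) (q : 'I_n -> R)
    (V : 'M[R]_n) (l : 'rV[R]_n) (M := weighted_mx A p q) (T : {set 'I_n}) :
    V *m (M^T *m M) *m V^T = diag_mx l ->
  (forall i, i \in T -> l 0 i != 0) -> (#|T| <= \rank A)%N.
Proof.
move=> Vl lT.
have hinj : injective (fun i : 'I_#|T| => enum_val i) by exact: enum_val_inj.
have lu : diag_mx (\row_(i < #|T|) l 0 (enum_val i)) \in unitmx.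
  rewrite unitmxE det_diag unitfE; apply/prodf_neq0 => i _.
  by rewrite mxE lT // enum_valP.
rewrite -(mxrank_unit lu) -(diag_submx_spectrum hinj Vl).
have -> : M = diag_mx (\row_i Num.sqrt (p i)) *m A *m diag_mx (\row_j Num.sqrt (q j)).
  by rewrite mul_diag_mx mul_mx_diag; apply/matrixP=> i j; rewrite !mxE.
rewrite !mulmxA; do 2 apply: (leq_trans (mxrankM_maxl _ _)).
exact: mxrankM_maxr.
Qed.

(** Column [j] of [M *m V^T] has squared norm [l 0 j]. *)
Lemma mulmx_spectral_support m n (M : 'M[R]_(m, n)) (V : 'M[R]_n) (l : 'rV[R]_n) i j :
  V *m (M^T *m M) *m V^T = diag_mx l -> l 0 j = 0 -> (M *m V^T) i j = 0.
Proof.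
move=> Vl lj.
have E : (M *m V^T)^T *m (M *m V^T) = diag_mx l.
  by rewrite trmx_mul trmxK -Vl !mulmxA.
have /eqP : ((M *m V^T)^T *m (M *m V^T)) j j = 0 by rewrite E mxE eqxx lj.
rewrite mxE psumr_eq0 => [|k _]; last by rewrite mxE -expr2 sqr_ge0.
move=> /allP/(_ i); rewrite mem_index_enum => /(_ isT).
by rewrite mxE -expr2 sqrf_eq0 => /eqP.
Qed.

(* With the spectral decomposition V (M^T M) V^T = diag l, the factors are
   M V^T diag(l^(-1/4)) and diag(l^(1/4)) V; vanishing l j are harmless since
   0^-1 = 0 and the corresponding columns of M V^T are zero. *)
Lemma nuclear_factorization m n (M : 'M[R]_(m, n)) (V : 'M[R]_n) (l : 'rV[R]_n) :
    (forall i, 0 <= l 0 i) -> V *m V^T = 1%:M ->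
    V *m (M^T *m M) *m V^T = diag_mx l ->
  exists (X : 'M[R]_(m, n)) (Y : 'M[R]_n),
    [/\ M = X *m Y,
        \sum_i \sum_j X i j ^+ 2 = \sum_j Num.sqrt (l 0 j)
      & \sum_j \sum_i Y i j ^+ 2 = \sum_j Num.sqrt (l 0 j)].
Proof.
move=> l0 V1 Vl.
pose s j := Num.sqrt (Num.sqrt (l 0 j)).
have s2 j : s j ^+ 2 = Num.sqrt (l 0 j) by rewrite sqr_sqrtr ?sqrtr_ge0.
have E : (M *m V^T)^T *m (M *m V^T) = diag_mx l.
  by rewrite trmx_mul trmxK -Vl !mulmxA.
have Wj i j : l 0 j = 0 -> (M *m V^T) i j = 0.
  by move=> lj; exact: mulmx_spectral_support Vl lj.
have MW : M *m V^T *m V = M by rewrite -mulmxA (mulmx1C V1) mulmx1.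
move: (M *m V^T) E Wj MW => W E Wj MW.
exists (W *m diag_mx (\row_j (s j)^-1)), (diag_mx (\row_j s j) *m V).
split.
- rewrite mulmxA -(mulmxA W) mulmx_diag -[LHS]MW; congr (_ *m _).
  rewrite mul_mx_diag; apply/matrixP=> i j; rewrite !mxE.
  have [lj|lj] := eqVneq (l 0 j) 0; first by rewrite Wj // mul0r.
  rewrite mulVf ?mulr1 //.
  by rewrite gt_eqF // !sqrtr_gt0 lt_neqAle eq_sym lj l0.
- rewrite exchange_big; apply: eq_bigr => j _ /=.
  transitivity ((s j) ^- 2 * \sum_i W i j ^+ 2).
    rewrite mulr_sumr; apply: eq_bigr => i _.
    by rewrite mul_mx_diag !mxE exprMn exprVn mulrC.
  have -> : \sum_i W i j ^+ 2 = l 0 j.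
    transitivity ((W^T *m W) j j).
      by rewrite mxE; apply: eq_bigr => i _; rewrite mxE expr2.
    by rewrite E mxE eqxx.
  rewrite s2; have [->|lj] := eqVneq (l 0 j) 0; first by rewrite sqrtr0 mulr0.
  rewrite -{2}(sqr_sqrtr (l0 j)) expr2 mulrA mulVf ?mul1r //.
  by rewrite gt_eqF // sqrtr_gt0 lt_neqAle eq_sym lj l0.
- rewrite exchange_big; apply: eq_bigr => i _ /=.
  transitivity (s i ^+ 2 * \sum_j V i j ^+ 2).
    rewrite mulr_sumr; apply: eq_bigr => j _.
    by rewrite mul_diag_mx 2!mxE exprMn.
  have -> : \sum_j V i j ^+ 2 = (V *m V^T) i i.
    by rewrite mxE; apply: eq_bigr => j _; rewrite mxE expr2.
  by rewrite V1 mxE eqxx mulr1.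
Qed.

(** The nuclear factorization of the weighted matrix is divided by the square roots of the weights,
    which needs them positive; each weighted sum is then the nuclear norm. *)
Lemma weighted_factorization m n (A : 'M[R]_(m, n)) (p : 'I_m -> R) (q : 'I_n -> R) :
    (forall i, 0 < p i) -> (forall j, 0 < q j) ->
  exists (B : 'M[R]_(m, n)) (C : 'M[R]_n), A = B *m C /\
    \sum_i p i * (\sum_j B i j ^+ 2) + \sum_j q j * (\sum_i C i j ^+ 2) <=
    expR 1 * (\sum_(k < \rank A) k.+1%:R^-1) * detlb A * (\sum_i p i + \sum_j q j).
Proof.
move=> p0 q0; pose M := weighted_mx A p q.
have [V [l [V1 Vl l0]]] := gram_spectral M^T; rewrite trmxK in Vl.
have [X [Y [MXY Xs Ys]]] := nuclear_factorization l0 V1 Vl.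
have pw i : 0 <= p i by exact: ltW.
have qw i : 0 <= q i by exact: ltW.
have sp i : Num.sqrt (p i) != 0 by rewrite gt_eqF // sqrtr_gt0.
have sq i : Num.sqrt (q i) != 0 by rewrite gt_eqF // sqrtr_gt0.
exists (diag_mx (\row_i (Num.sqrt (p i))^-1) *m X),
       (Y *m diag_mx (\row_j (Num.sqrt (q j))^-1)); split.
  rewrite mulmxA -(mulmxA _ X Y) -MXY mul_diag_mx mul_mx_diag.
  apply/matrixP=> i j; rewrite !mxE; field.
  by rewrite sp sq.
have -> : \sum_i p i * (\sum_j (diag_mx (\row_i (Num.sqrt (p i))^-1) *m X) i j ^+ 2)
    = \sum_j Num.sqrt (l 0 j).
  rewrite -Xs; apply: eq_bigr => i _; rewrite mulr_sumr; apply: eq_bigr => j _.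
  rewrite mul_diag_mx 2!mxE exprMn exprVn sqr_sqrtr // mulrA mulfV ?mul1r //.
  by rewrite gt_eqF.
have -> : \sum_j q j * (\sum_i (Y *m diag_mx (\row_j (Num.sqrt (q j))^-1)) i j ^+ 2)
    = \sum_j Num.sqrt (l 0 j).
  rewrite -Ys; apply: eq_bigr => i _; rewrite mulr_sumr; apply: eq_bigr => j _.
  rewrite mul_mx_diag 2!mxE exprMn exprVn sqr_sqrtr // mulrCA mulfV ?mulr1 //.
  by rewrite gt_eqF.
set a := \sum_i p i; set b := \sum_j q j.
have a0 : 0 <= a by apply: sumr_ge0.
have b0 : 0 <= b by apply: sumr_ge0.
pose c := detlb A * Num.sqrt (a * b).
have c0 : 0 <= c by rewrite mulr_ge0 ?detlb_ge0 ?sqrtr_ge0.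
(* Dropping zero singular values leaves at most [\rank A] terms in the harmonic sum. *)
pose S := [set j | l 0 j != 0].
have -> : \sum_j Num.sqrt (l 0 j) = \sum_(j in S) Num.sqrt (l 0 j).
  rewrite [RHS]big_mkcond; apply: eq_bigr => j _; rewrite inE.
  by case: eqVneq => //= ->; rewrite sqrtr0.
have Sc : \sum_(j in S) Num.sqrt (l 0 j) <=
    expR 1 * c * \sum_(k < #|S|) k.+1%:R^-1.
  apply: sum_le_harmonic => // [j|T _]; first exact: sqrtr_ge0.
  rewrite ler_pdivlMr ?ltr0n ?fact_gt0 //.
  have L0 : 0 <= \prod_(j in T) Num.sqrt (l 0 j) * (#|T|)`!%:R.
    by rewrite mulr_ge0 ?ler0n // prodr_ge0 // => j _; exact: sqrtr_ge0.
  have R0 : 0 <= c ^+ #|T| by exact: exprn_ge0.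
  rewrite -ler_sqr //.
  rewrite mulrC exprMn -prodrXl.
  under eq_bigr do rewrite sqr_sqrtr //.
  have := prod_spectrum_le T pw qw V1 Vl.
  rewrite [X in _ <= X -> _](_ : _ = (c ^+ #|T|) ^+ 2) //.
  by rewrite exprAC; congr (_ ^+ _); rewrite exprMn sqr_sqrtr ?mulr_ge0 // mulrA.
have ScR : \sum_(k < #|S|) k.+1%:R^-1 <= \sum_(k < \rank A) k.+1%:R^-1 :> R.
  have Sr : (#|S| <= \rank A)%N.
    by apply: (card_spectrum_le Vl) => j; rewrite inE.
  rewrite (big_ord_widen _ (fun k => k.+1%:R^-1) Sr) big_mkcond /=.
  by apply: ler_sum => k _; case: ifP => // _; rewrite invr_ge0.
(* AM-GM: 2 sqrt(ab) <= a + b. *)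
have c2 : c + c <= detlb A * (a + b).
  rewrite -mulrDr ler_wpM2l ?detlb_ge0 //.
  have := sqr_ge0 (Num.sqrt a - Num.sqrt b).
  by rewrite sqrrB !sqr_sqrtr // -sqrtrM //; lra.
set h := \sum_(k < \rank A) _ in ScR *.
have h0 : 0 <= h by apply: sumr_ge0 => k _; rewrite invr_ge0.
have e0 : 0 <= expR 1 :> R by exact: expR_ge0.
apply: (@le_trans _ _ (expR 1 * h * (c + c))).
  have := le_trans Sc (ler_wpM2l (mulr_ge0 e0 c0) ScR).
  by move=> H; have := lerD H H; rewrite -mulrDl -mulrDr => /le_trans; apply; rewrite mulrAC.
by rewrite -[leRHS]mulrA ler_wpM2l // mulr_ge0.
Qed.

End NuclearFactorization.

(** * Separation of a convex set from a box *)

Section Separation.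
Variables (R : realType) (I : finType).

(** Second-order upper bound for the square of the positive part, whose derivative is
    [2 * Num.max u 0]; it controls one descent step. *)
Lemma sqr_max0_le (u h : R) :
  Num.max (u + h) 0 ^+ 2 <= Num.max u 0 ^+ 2 + 2 * Num.max u 0 * h + h ^+ 2.
Proof.
have [u0|/ltW u0] := leP u 0; last first.
  have [uh|_] := leP (u + h) 0; last by rewrite le_eqVlt; apply/orP; left; apply/eqP; ring.
  by rewrite expr0n /=; have := sqr_ge0 (u + h); lra.
rewrite expr0n /= mulr0 mul0r !add0r.
have [_|uh] := leP (u + h) 0; first by rewrite expr0n /= sqr_ge0.
by apply: lerXn2r; rewrite ?nnegrE; lra.
Qed.

(* w is the normalised gradient at a near-minimiser over K of the squared
   distance to the orthant {x <= s}; restricting to y bounded by L makes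
   near-minimality suffice, so K need not be closed. *)
Lemma bounded_separation (K : set (I -> R)) (s s' L : R) :
    0 <= s -> s < s' -> (exists x, K x) ->
    (forall x i, K x -> 0 <= x i) ->
    (forall x y (t : R), K x -> K y -> 0 <= t <= 1 -> K (fun i => x i + t * (y i - x i))) ->
    (forall x, K x -> exists i, s' <= x i) ->
  exists w : I -> R, [/\ forall i, 0 <= w i, \sum_i w i = 1 &
    forall y, K y -> (forall i, y i <= L) -> s <= \sum_i w i * y i].
Proof.
move=> s0 ss' [x1 Kx1] K0 Kconv Ks'.
pose v (x : I -> R) i : R := Num.max (x i - s) 0.
pose Phi x : R := \sum_i v x i ^+ 2.
have v0 x i : 0 <= v x i by rewrite /v le_max lexx orbT.
pose E : set R := fun r => exists2 x, K x & r = Phi x.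
have Elb r : E r -> (s' - s) ^+ 2 <= r.
  move=> [x Kx ->]; have [i xi] := Ks' _ Kx.
  rewrite /Phi (bigD1 i) //= -[leLHS]addr0; apply: lerD; last first.
    by apply: sumr_ge0 => j _; exact: sqr_ge0.
  have ds : 0 <= s' - s by rewrite subr_ge0 ltW.
  apply: lerXn2r; rewrite ?nnegrE ?v0 //.
  by rewrite /v le_max lerD2r xi.
have E0 : (E !=set0)%classic by exists (Phi x1), x1.
have Einf : has_inf E by split=> //; exists ((s' - s) ^+ 2) => r /Elb.
pose d := inf E.
have d0 : 0 < d.
  apply: (@lt_le_trans _ _ ((s' - s) ^+ 2)); first by rewrite exprn_gt0 // subr_gt0.
  by apply: lb_le_inf => // r /Elb.
have dle x : K x -> d <= Phi x.
  by move=> Kx; apply: ge_inf; [case: Einf | exists x].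
(* [Q] bounds every |y_i - x_i|, as 0 <= x_i <= s + d + 1 and 0 <= y_i <= L; [N] then bounds the
   squared distance from [x] to [y]. *)
pose Q := `|L| + s + d + 1.
have Q0 : 0 < Q by rewrite /Q; have := normr_ge0 L; lra.
pose N := #|I|%:R * Q ^+ 2.
have N0 : 0 <= N by rewrite mulr_ge0 // sqr_ge0.
(* Step length from [x] towards [y], small enough that the quadratic term [th ^+ 2 * N] is at most
   [th * d]. *)
pose th := d / (d + N).
have dN : 0 < d + N by lra.
have th0 : 0 < th by rewrite divr_gt0.
have th1 : th <= 1 by rewrite ler_pdivrMr //; lra.
have thN : th * N <= d.
  by rewrite /th mulrAC ler_pdivrMr // ler_wpM2l //; lra.
(* Tolerance of the near-minimiser; d / (1 + d) lies below both 1 and d. *)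
pose eta := th * (d / (1 + d)).
have dd0 : 0 < d / (1 + d) by rewrite divr_gt0 //; lra.
have dd1 : d / (1 + d) <= 1 by rewrite ler_pdivrMr; lra.
have ddd : d / (1 + d) <= d by rewrite ler_pdivrMr; nra.
have eta0 : 0 < eta by rewrite mulr_gt0.
have eta1 : eta <= 1 by rewrite /eta -[leRHS]mul1r ler_pM // ltW.
have etad : eta <= th * d by rewrite ler_wpM2l // ltW.
have [_ [x Kx ->] xeta] := inf_adherent eta0 Einf.
rewrite -/d in xeta.
have vd i : v x i <= d + 1.
  have : v x i ^+ 2 <= d + 1.
    apply: (@le_trans _ _ (Phi x)); last by lra.
    rewrite /Phi (bigD1 i) //= lerDl.
    by apply: sumr_ge0 => j _; exact: sqr_ge0.
  by have := v0 x i; move: (v x i) => z z0; nra.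
have xi i : x i - s <= v x i by rewrite /v le_max lexx.
pose W := \sum_i v x i.
have W0 : 0 < W.
  rewrite lt_neqAle sumr_ge0 // andbT eq_sym psumr_neq0 //.
  apply: contraTT (lt_le_trans d0 (dle _ Kx)) => /hasPn H.
  rewrite -leNgt /Phi big1 // => i _; apply/eqP; rewrite sqrf_eq0 eq_le v0 andbT.
  by have := H i (mem_index_enum _); rewrite -leNgt.
exists (fun i => v x i / W); split.
- by move=> i; rewrite divr_ge0 // ltW.
- by rewrite -mulr_suml divff ?gt_eqF.
move=> y Ky yL.
have yx i : (y i - x i) ^+ 2 <= Q ^+ 2.
  rewrite -[leLHS]real_normK ?num_real //; have Qw := ltW Q0.
  apply: lerXn2r; rewrite ?nnegrE //.
  rewrite ler_norml; have := ler_norm L; have := K0 _ i Ky; have := K0 _ i Kx.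
  by have := xi i; have := vd i; have := yL i; rewrite /Q; move: `|L| => *; lra.
have Hconv := dle _ (Kconv x y th Kx Ky _); rewrite th1 ltW // in Hconv.
have {Hconv} Hd := Hconv isT.
have Hle : Phi (fun i => x i + th * (y i - x i)) <=
    Phi x + 2 * th * (\sum_i v x i * (y i - x i)) + th ^+ 2 * N.
  have -> : N = \sum_(i : I) Q ^+ 2 by rewrite sumr_const /N mulr_natl.
  rewrite /Phi !mulr_sumr -!big_split /=; apply: ler_sum => i _.
  rewrite {1}/v [x i + _ - s]addrAC; apply: (le_trans (sqr_max0_le _ _)).
  have E2 : (th * (y i - x i)) ^+ 2 <= th ^+ 2 * Q ^+ 2.
    by rewrite exprMn ler_wpM2l ?sqr_ge0.
  apply: lerD E2; rewrite -/(v x i) lerD2l le_eqVlt; apply/orP; left.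
  by apply/eqP; ring.
(* Near-minimality gives 0 <= eta + 2 th z + th^2 N for the sum z; the two error terms total at most
   2 th d. *)
have vyx : - d <= \sum_i v x i * (y i - x i).
  move: Hle Hd xeta; move: (\sum_i v x i * _) (Phi _) (Phi _) => z f1 f2 *.
  by rewrite -(ler_pM2l th0); nra.
(* Where [v x i] is nonzero, [x i = s + v x i]. The surplus [d] offsets the loss in [vyx]. *)
have vx : s * W + d <= \sum_i v x i * x i.
  rewrite (le_trans (lerD (lexx _) (dle _ Kx))) // mulr_sumr -big_split /=.
  apply: ler_sum => i _; rewrite /v; have [_|_] := leP (x i - s) 0.
    by rewrite expr0n /= mulr0 mul0r addr0.
  by rewrite le_eqVlt; apply/orP; left; apply/eqP; ring.
rewrite (eq_bigr (fun i => (v x i * y i) / W)); last by move=> i _; rewrite mulrAC.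
rewrite -mulr_suml ler_pdivlMr //.
have -> : \sum_i v x i * y i = \sum_i v x i * (y i - x i) + \sum_i v x i * x i.
  by rewrite -big_split /=; apply: eq_bigr => i _; ring.
lra.
Qed.

End Separation.

(** * Both bounds for [gamma2] *)

Section Gamma2.
Variable R : realType.

Lemma gamma2_le_factorization m n p (B : 'M[R]_(m, p)) (C : 'M[R]_(p, n)) :
  gamma2 (B *m C) <= norm_2_inf B * norm_1_2 C.
Proof.
apply: ge_inf; last by exists p, B, C.
exists 0 => _ [p' [B' [C' [_ ->]]]].
by rewrite norm_1_2_tr mulr_ge0 ?norm_2_inf_ge0.
Qed.

Lemma detlb_le_gamma2 m n (A : 'M[R]_(m, n)) : detlb A <= gamma2 A.
Proof.
apply: lb_le_inf.
  by exists (norm_2_inf A * norm_1_2 (1%:M : 'M[R]_n)), n, A, 1%:M; rewrite mulmx1.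
by move=> _ [p [B [C [-> ->]]]]; exact: detlb_le_factorization.
Qed.

Lemma norm_2_inf_le m p (B : 'M[R]_(m, p)) (s : R) : 0 <= s ->
  (forall i, \sum_j B i j ^+ 2 <= s) -> norm_2_inf B <= Num.sqrt s.
Proof.
move=> s0 Bs; apply: bigmax_le => [|i _]; first exact: sqrtr_ge0.
exact: ler_wsqrtr.
Qed.

(** Squares are recorded because they add under concatenation of factors, which makes the set
    convex; the sum type puts rows and columns in one vector. *)
Definition factor_sqnorms m n (A : 'M[R]_(m, n)) : set ('I_m + 'I_n -> R) :=
  fun x => exists (p : nat) (B : 'M[R]_(m, p)) (C : 'M[R]_(p, n)),
    [/\ A = B *m C, forall i, x (inl i) = \sum_j B i j ^+ 2
      & forall j, x (inr j) = \sum_i C i j ^+ 2].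

(* Convex combinations are realised by concatenating rescaled factors. *)
Lemma factor_sqnorms_convex m n (A : 'M[R]_(m, n)) x y (t : R) :
  factor_sqnorms A x -> factor_sqnorms A y -> 0 <= t <= 1 ->
  factor_sqnorms A (fun i => x i + t * (y i - x i)).
Proof.
move=> [p1 [B1 [C1 [A1 xl1 xr1]]]] [p2 [B2 [C2 [A2 xl2 xr2]]]] /andP[t0 t1].
pose u := Num.sqrt (1 - t); pose v := Num.sqrt t.
have u2 : u ^+ 2 = 1 - t by rewrite sqr_sqrtr // subr_ge0.
have v2 : v ^+ 2 = t by rewrite sqr_sqrtr.
exists (p1 + p2)%N, (row_mx (u *: B1) (v *: B2)), (col_mx (u *: C1) (v *: C2)).
split.
- rewrite mul_row_col -!scalemxAl -!scalemxAr !scalerA -A1 -A2 -!expr2 u2 v2.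
  by rewrite -scalerDl subrK scale1r.
- move=> i; rewrite big_split_ord /= xl1 xl2.
  under [X in _ = X + _]eq_bigr do rewrite row_mxEl mxE exprMn u2.
  under [X in _ = _ + X]eq_bigr do rewrite row_mxEr mxE exprMn v2.
  by rewrite -!mulr_sumr; ring.
- move=> j; rewrite big_split_ord /= xr1 xr2.
  under [X in _ = X + _]eq_bigr do rewrite col_mxEu mxE exprMn u2.
  under [X in _ = _ + X]eq_bigr do rewrite col_mxEd mxE exprMn v2.
  by rewrite -!mulr_sumr; ring.
Qed.

(** If every coordinate were below [s], both norms would be at most sqrt(s), and so [gamma2 A] at
    most [s]. *)
Lemma factor_sqnorms_gamma2 m n (A : 'M[R]_(m, n)) (s : R) x :
  0 <= s -> s < gamma2 A -> factor_sqnorms A x -> exists i, s <= x i.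
Proof.
move=> s0 sg [p [B [C [AE xl xr]]]].
have [/existsP//|] := boolP [exists i, s <= x i].
rewrite negb_exists => /forallP xs; exfalso; move: sg; rewrite ltNge => /negP; apply.
have xs' i : x i <= s by have := xs i; rewrite -ltNge => /ltW.
rewrite AE (le_trans (gamma2_le_factorization _ _)) //.
rewrite -[leRHS]sqr_sqrtr // expr2 norm_1_2_tr; apply: ler_pM.
- exact: norm_2_inf_ge0.
- exact: norm_2_inf_ge0.
- by apply: norm_2_inf_le => // i; rewrite -xl.
- apply: norm_2_inf_le => // j; apply: le_trans (xs' (inr j)).
  by rewrite xr; apply: ler_sum => i _; rewrite mxE.
Qed.

Lemma gamma2_le_harmonic m n (A : 'M[R]_(m, n)) :
  gamma2 A <= expR 1 * (\sum_(k < \rank A) k.+1%:R^-1) * detlb A.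
Proof.
set T := leRHS; rewrite leNgt; apply/negP => Tg.
have T0 : 0 <= T.
  rewrite !mulr_ge0 ?expR_ge0 ?detlb_ge0 //.
  by apply: sumr_ge0 => k _; rewrite invr_ge0.
have [s Ts sg] : exists2 s, T < s & s < gamma2 A.
  by exists ((T + gamma2 A) / 2); lra.
have [s' ss' s'g] : exists2 s', s < s' & s' < gamma2 A.
  by exists ((s + gamma2 A) / 2); lra.
have s0 : 0 <= s by lra.
pose N : R := (m + n)%:R.
(* Chosen so that enlarging the total mass from 1 to [1 + N * eps] keeps the bound below [s]. *)
pose eps := (s - T) / (T * N + 1).
have N0 : 0 <= N by exact: ler0n.
have TN : 0 < T * N + 1 by have := mulr_ge0 T0 N0; lra.
have eps0 : 0 < eps by rewrite divr_gt0 // subr_gt0.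
have epsT : T * (1 + N * eps) < s.
  have : eps * (T * N + 1) = s - T by rewrite divfK ?gt_eqF.
  by lra.
pose U := T * (1 + N * eps).
have Knonneg x i : factor_sqnorms A x -> 0 <= x i.
  case=> p [B [C [_ xl xr]]].
  by case: i => i; rewrite ?xl ?xr sumr_ge0 // => j _; exact: sqr_ge0.
have Kne : exists x, factor_sqnorms A x.
  exists (fun i => match i with inl i => \sum_j A i j ^+ 2
                   | inr j => \sum_i (1%:M : 'M[R]_n) i j ^+ 2 end).
  by exists n, A, 1%:M; rewrite mulmx1.
have [w [w0 w1 wK]] := @bounded_separation R _ (factor_sqnorms A) s s' (U / eps)
   s0 ss' Kne Knonneg (@factor_sqnorms_convex m n A)
   (fun x Kx => factor_sqnorms_gamma2 (ltW (le_lt_trans s0 ss')) s'g Kx).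
(* The shift makes every weight at least [eps]: the weights are positive, and a weighted sum at most
   [U] forces each squared norm below [U / eps], the cutoff used for the separation. *)
pose p i := w (inl i) + eps; pose q j := w (inr j) + eps.
have p0 i : 0 < p i by rewrite ltr_wpDl.
have q0 i : 0 < q i by rewrite ltr_wpDl.
have [B [C [AE]]] := weighted_factorization A p0 q0.
have -> : \sum_i p i + \sum_j q j = 1 + N * eps.
  rewrite -w1 big_sumType /= /p /q !big_split /= !sumr_const !card_ord.
  by rewrite /N natrD -[eps *+ m]mulr_natl -[eps *+ n]mulr_natl; ring.
rewrite -/T -/U => BC.
have pB0 i : 0 <= p i * (\sum_j B i j ^+ 2).
  by apply: mulr_ge0; [exact: ltW | apply: sumr_ge0 => j _; exact: sqr_ge0].
have qC0 j : 0 <= q j * (\sum_i C i j ^+ 2).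
  by apply: mulr_ge0; [exact: ltW | apply: sumr_ge0 => i _; exact: sqr_ge0].
pose y (i : 'I_m + 'I_n) : R :=
  match i with inl i => \sum_j B i j ^+ 2 | inr j => \sum_i C i j ^+ 2 end.
have Ky : factor_sqnorms A y by exists n, B, C.
have y0 i : 0 <= y i by exact: Knonneg.
suff yU i : y i <= U / eps.
  (* Since [w] is dominated by [p] and [q], the separated sum is at most [U], which is less than
     [s]. *)
  have := wK y Ky yU; apply/negP; rewrite -ltNge; apply: le_lt_trans epsT.
  apply: le_trans BC; rewrite big_sumType /=.
  apply: lerD; apply: ler_sum => i _; apply: ler_wpM2r.
  - exact: (y0 (inl i)).
  - by rewrite lerDl ltW.
  - exact: (y0 (inr i)).
  - by rewrite lerDl ltW.
rewrite ler_pdivlMr // mulrC; apply: le_trans BC.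
case: i => i /=.
  rewrite (bigD1 i) //= -addrA -[leLHS]addr0; apply: lerD.
    by apply: ler_wpM2r; [exact: (y0 (inl i)) | rewrite lerDr].
  by apply: addr_ge0; apply: sumr_ge0.
rewrite addrC [X in _ <= X + _](bigD1 i) //= -addrA -[leLHS]addr0; apply: lerD.
  by apply: ler_wpM2r; [exact: (y0 (inr i)) | rewrite lerDr].
by apply: addr_ge0; apply: sumr_ge0.
Qed.

End Gamma2.

Theorem theorem3p1 :
  exists C : Rdefinitions.R, 0 < C /\
    forall (m n : nat) (A : 'M[Rdefinitions.R]_(m, n)),
      detlb A <= gamma2 A /\
      gamma2 A <= C * Num.max 1 (ln ((\rank A)%:R)) * detlb A.
Proof.
(* The factor e comes from k^k <= e^k k!, the factor 2 from the harmonic sum. *)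
exists (2 * expR 1); split; first by rewrite mulr_gt0 ?expR_gt0.
move=> m n A; split; first exact: detlb_le_gamma2.
apply: (le_trans (gamma2_le_harmonic A)).
rewrite ler_wpM2r ?detlb_ge0 // [2 * _]mulrC -mulrA ler_wpM2l ?expR_ge0 //.
exact: harmonic_le_ln.
Qed.
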